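(* Let $G = (X, Y; E)$ be a connected balanced bipartite graph of order $2n$ with $n \geq 4$, with $e$ edges and minimum degree $\delta \geq 2$. Let $q_1$ be the largest eigenvalue of the signless Laplacian matrix $Q(G) = D(G) + A(G)$. If $$q_1 \geq \frac{2(n^2 - n + 2)}{n},$$ then $G$ is bipancyclic.
   Context: Graphs are finite, undirected, without loops or multiple edges. $A(G)$ is the adjacency matrix and $D(G)$ the diagonal matrix of vertex degrees. A bipartite graph $G=(X,Y;E)$ with parts $X$ and $Y$ is balanced if $|X|=|Y|$. A bipartite graph $G$ is bipancyclic if it contains cycles of every even length from $4$ to $|V(G)|$. *)

(* Defs.v *)
From mathcomp Require Import all_boot all_order all_algebra.
From mathcomp Require Import reals.

Set Implicit Arguments.
Unset Strict Implicit.
Unset Printing Implicit Defensive.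

Import GRing.Theory.

Record sgraph := SGraph {
  vertex :> finType;
  adj : rel vertex;
  adj_sym : symmetric adj;
  adj_irr : irreflexive adj }.

Section GraphNotions.

Variable G : sgraph.

Definition deg (x : G) : nat := #|[set y | adj x y]|.

(* Degrees are < #|G|, so the default value #|G| only matters for the empty
   graph. *)
Definition min_degree : nat := \big[minn/#|G|]_(x : G) deg x.

Definition edges : {set {set G}} :=
  [set [set p.1; p.2] | p : G * G & adj p.1 p.2].

Definition connected_graph : Prop := forall x y : G, connect (@adj G) x y.

Definition bipartite_with (X Y : {set G}) : Prop :=
  [/\ X :|: Y = [set: G],
      X :&: Y = set0 &
      forall x y : G, adj x y ->
        (x \in X) && (y \in Y) || (x \in Y) && (y \in X)].

(* The bound 3 <= k excludes the degenerate closed walks u, v, u accepted by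
   [ucycle]. *)
Definition has_cycle_of_length (k : nat) : Prop :=
  3 <= k /\ exists c : seq G, ucycle (@adj G) c /\ size c = k.

Definition bipancyclic : Prop :=
  forall k : nat, ~~ odd k -> 4 <= k <= #|G| -> has_cycle_of_length k.

Local Open Scope ring_scope.

Variable R : realType.

Definition adjacency_mx : 'M[R]_#|G| :=
  \matrix_(i, j) (adj (enum_val i) (enum_val j))%:R.

Definition degree_mx : 'M[R]_#|G| :=
  diag_mx (\row_i (deg (enum_val i))%:R).

Definition signless_laplacian : 'M[R]_#|G| := degree_mx + adjacency_mx.

End GraphNotions.

Definition largest_eigenvalue (R : realType) (m : nat) (M : 'M[R]_m) (q : R) :
    Prop :=
  eigenvalue M q /\ (forall a : R, eigenvalue M a -> (a <= q)%R).

(* Main.v *)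
(** Write [d] for the degree of a vertex and [S] for the sum of the degrees of
    its neighbours. An eigenvector of the signless Laplacian, scaled by the
    degrees, shows that [q1 * d < d^2 + S] at some vertex or [q1 * d <= d^2 + S]
    at every vertex. Since [S] is at most [d * n] and at most the number of
    edges, the lower bound on [q1] leaves at most [2n - 5] missing edges
    between the two parts in the first case, and at most one missing edge per
    vertex in the second.

    A missing edge whose ends miss at most [n - 1] neighbours in total can be
    added without changing whether the graph is Hamiltonian (the bipartite
    Bondy-Chvatal closure). With at most [2n - 5] missing edges and minimum
    degree at least 2 such an edge exists as long as the graph is not complete
    bipartite, so the graph is Hamiltonian. Deleting the worst vertex of each
    part preserves both conditions, which yields the shorter cycles. *)

Require Import Defs.
From mathcomp Require Import all_boot all_order all_algebra.
From mathcomp Require Import reals zify lra.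
Set Implicit Arguments.
Unset Strict Implicit.
Unset Printing Implicit Defensive.
Import Order.TTheory GRing.Theory Num.Theory.

(** * Missing edges and the closure step *)

Section Bipartite.
Variable T : finType.
Implicit Types (e : rel T) (X Y : {set T}) (c : seq T).

Definition bip_rel X Y e :=
  forall a b, e a b -> (a \in X) && (b \in Y) || (a \in Y) && (b \in X).

(** The degree of [v] in the bipartite complement when [S] is the part opposite to [v]; not a count
    of common neighbours. *)
Definition codeg e (S : {set T}) (v : T) := #|[set w in S | ~~ e v w]|.

Definition nonedges e X Y := \sum_(x in X) codeg e Y x.

Definition add_edge e (x y : T) : rel T :=
  fun a b => [|| e a b, (a == x) && (b == y) | (a == y) && (b == x)].

Lemma add_edge_sym e x y : symmetric e -> symmetric (add_edge e x y).
Proof.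
move=> sym_e a b; rewrite /add_edge sym_e; congr (_ || _).
by rewrite orbC andbC; congr (_ || _); rewrite andbC.
Qed.

Lemma codeg_card e (S : {set T}) v : codeg e S v + #|[set w in S | e v w]| = #|S|.
Proof.
rewrite addnC -(cardsID [set w | e v w] S); congr (_ + _); apply: eq_card => w.
  by rewrite !inE.
by rewrite !inE andbC.
Qed.

Lemma nonedgesC e X Y : symmetric e -> nonedges e Y X = nonedges e X Y.
Proof.
move=> sym_e; rewrite /nonedges /codeg.
under eq_bigr do rewrite -sum1dep_card.
under [RHS]eq_bigr do rewrite -sum1dep_card.
rewrite (exchange_big_dep (mem X)) /=; last by move=> ? ? _ /andP[].
apply: eq_bigr => x xX; apply: eq_bigl => y; by rewrite xX sym_e.
Qed.

(** Count the missing pairs from the side of [Y]: each non-neighbour of [x] contributes at least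
    [k]. *)
Lemma nonedges_ge e X Y x k : x \in X ->
  (forall y, y \in Y -> ~~ e x y -> k <= codeg e X y) -> symmetric e ->
  codeg e Y x * k <= nonedges e X Y.
Proof.
move=> xX kP sym_e; rewrite -nonedgesC // /nonedges /codeg -sum_nat_const.
rewrite big_mkcond [leqRHS]big_mkcond leq_sum // => y _; rewrite inE.
case: ifP => // /andP[yY nxy]; rewrite yY; exact: kP.
Qed.

(* If [yx] is a step of [c], the degree condition gives another step [wz] with
   [z] adjacent to [x] and [w] to [y]; replacing the two steps by [xz] and [yw]
   gives a cycle that avoids [xy]. *)
Lemma crossing_cycle e X Y x y c : symmetric e -> bip_rel X Y e ->
  [disjoint X & Y] -> #|X| = #|Y| -> x \in X -> y \in Y -> ~~ e x y ->
  codeg e Y x + codeg e X y < #|X| ->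
  uniq c -> cycle (add_edge e x y) c -> c =i X :|: Y ->
  exists c', [/\ uniq c', cycle e c' & c' =i X :|: Y].
Proof.
move=> sym_e bip dXY eqXY xX yY nxy small Uc Cc cE.
have sym_e' := add_edge_sym x y sym_e.
have xnY : x \notin Y by rewrite (disjointFr dXY).
have ynX : y \notin X by rewrite (disjointFl dXY).
have neq_xy : x != y by apply: contraNneq xnY => ->.
have [avoid|] := boolP ((next c x != y) && (prev c x != y)).
  exists c; split=> //; apply: cycle_from_next => // z zc.
  have := next_cycle Cc zc; rewrite /add_edge; case/or3P => //.
    by case/andP=> /eqP-> /eqP nE; move: avoid; rewrite nE eqxx.
  case/andP=> /eqP-> /eqP nE; move: avoid; rewrite -{2}nE prev_next //.
  by rewrite eqxx andbF.
rewrite negb_and !negbK => nbr.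
(* Reversing the cycle exchanges predecessor and successor. *)
wlog /eqP prevx : c Uc Cc cE nbr / prev c x == y.
  case/orP: nbr => [nx|px] wl; last by apply: (wl c) => //; rewrite px orbT.
  apply: (wl (rev c)); rewrite ?rev_uniq ?next_rev ?prev_rev ?nx ?orbT //.
    by rewrite rev_cycle (eq_cycle (e' := add_edge e x y)).
  by move=> z; rewrite mem_rev cE.
have nexty : next c y = x by rewrite -prevx next_prev.
pose N := [set z in Y | e x z].
(* Pigeonhole in [X]: the predecessors of the neighbours of [x] and the neighbours of [y] both lie
   there, and by [small] their numbers add up to more than [#|X|]. *)
have /set0Pn[w] : (prev c @: N) :&: [set w in X | e y w] != set0.
  rewrite -card_gt0; have := cardsUI (prev c @: N) [set w in X | e y w].
  rewrite card_imset; last exact: can_inj (next_prev Uc).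
  have subX : (prev c @: N) :|: [set w in X | e y w] \subset X.
    rewrite subUset; apply/andP; split; apply/subsetP => w; last first.
      by rewrite inE => /andP[].
    case/imsetP => z; rewrite inE => /andP[zY exz] ->.
    have zc : z \in c by rewrite cE inE zY orbT.
    have znX : z \notin X by rewrite (disjointFl dXY).
    have := prev_cycle Cc zc; rewrite /add_edge; case/or3P.
    - by move/bip; rewrite (negPf znX) andbF orbF => /andP[].
    - by case/andP=> /eqP->.
    - by case/andP=> _ /eqP zx; rewrite zx xX in znX.
  have := subset_leq_card subX.
  move: (codeg_card e Y x) (codeg_card e X y) eqXY small; rewrite -/N.
  by move: (prev c @: N) [set w in X | e y w] => A B; clear; lia.
rewrite 2!inE => /andP[/imsetP[z]]; rewrite inE => /andP[zY exz] -> /andP[wX eyw].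
have zc : z \in c by rewrite cE inE zY orbT.
have nzx : x != z by apply: contraNneq xnY => ->.
case: (rot_to zc) => i s rotc.
have mem_s u : (u \in z :: s) = (u \in X :|: Y) by rewrite -rotc mem_rot cE.
have Us : uniq (z :: s) by rewrite -rotc rot_uniq.
have Cs : cycle (add_edge e x y) (z :: s) by rewrite -rotc rot_cycle.
have Fs : fcycle (next c) (z :: s) by rewrite -rotc rot_cycle cycle_next.
have : x \in s by have := mem_s x; rewrite !inE xX (negPf nzx).
move=> xs; case/splitPr: xs mem_s Us Cs Fs {rotc} => s1 s2 mem_s Us Cs Fs.
have [lastz lastx] : last z s1 = y /\ last x s2 = prev c z.
  move: Fs; rewrite /= rcons_cat /= cat_path /= rcons_path.
  case/and4P => _ /eqP lz _ /eqP lx.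
  by split; [rewrite -prevx -lz prev_next | rewrite -[in RHS]lx prev_next].
(* The rotated cycle reads z..y x..w with w = [prev c z]; reversing its second half gives z..y w..x,
   joined by the edges yw and xz. *)
exists (z :: s1 ++ rev (x :: s2)).
have permP : perm_eq (z :: s1 ++ rev (x :: s2)) (z :: s1 ++ x :: s2).
  by rewrite perm_cons perm_cat2l perm_rev.
split; first by rewrite (perm_uniq permP).
  move: Cs; rewrite /= rcons_cat /= cat_path /= rcons_path.
  case/and4P => P1 _ P2 _.
  have R2 : rev (x :: s2) = prev c z :: rev (belast x s2).
    by rewrite lastI rev_rcons lastx.
  move: Us; rewrite -cat_cons cat_uniq => /and3P[_ /hasPn s2n /= /andP[xs2 _]].
  (* The first segment omits [x] and the second omits [y], so neither contains the added edge. *)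
  have ynin : y \notin x :: s2.
    by apply/negP=> /s2n; rewrite -lastz /= mem_last.
  have xnin : x \notin z :: s1 by apply: s2n; rewrite mem_head.
  rewrite rcons_cat cat_path lastz R2 /= eyw rcons_path /=; apply/and3P; split.
  - apply: (sub_in_path (P := predC1 x)) P1.
      move=> a b; rewrite !inE /add_edge => /negPf-> /negPf->.
      by rewrite !andbF !orbF.
    by apply/allP => u us /=; apply: contraNneq xnin => <-.
  - rewrite -lastx rev_path; apply: (sub_in_path (P := predC1 y)) P2.
      move=> a b; rewrite !inE /add_edge sym_e => /negPf-> /negPf->.
      by rewrite !andbF !orbF.
    by apply/allP => u us /=; apply: contraNneq ynin => <-.
  - have -> : last (prev c z) (rev (belast x s2)) = x; last by [].
    have := congr1 (last (prev c z)) R2; by rewrite /= rev_cons last_rcons.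
by move=> u; rewrite (perm_mem permP) mem_s.
Qed.

(** * Hamiltonian cycles in complete bipartite graphs *)

(** Surplus elements of the longer list are kept, so the result is always a permutation of the
    concatenation. *)
Fixpoint interleave (s t : seq T) : seq T :=
  match s, t with
  | a :: s', b :: t' => a :: b :: interleave s' t'
  | [::], _ => t
  | _, [::] => s
  end.

Lemma perm_interleave s t : perm_eq (interleave s t) (s ++ t).
Proof.
elim: s t => [|a s IH] [|b t] //=; first by rewrite cats0.
rewrite perm_cons perm_sym -cat_rcons -cats1 -catA perm_catCA /= perm_cons.
by rewrite perm_sym.
Qed.

(** The start [b] belongs to the side of [t], which makes the induction go through; the side of the
    last vertex is what later closes the path into a cycle. *)
Lemma path_interleave e b s t : size s = size t ->
  (forall u v, u \in s -> v \in b :: t -> e u v && e v u) ->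
  path e b (interleave s t) /\ last b (interleave s t) \in b :: t.
Proof.
elim: s t b => [|u s IH] [|v t] b //=; first by rewrite mem_head.
case=> sz adj_st.
have /andP[_ ->] : e u b && e b u by apply: adj_st; rewrite mem_head.
have /andP[-> _] : e u v && e v u by apply: adj_st; rewrite !inE eqxx ?orbT.
have [|-> lst] := IH t v sz.
  by move=> a d aS dT; apply: adj_st; rewrite inE ?aS ?dT orbT.
by split=> //; rewrite inE lst orbT.
Qed.

Lemma complete_bipartite_cycle e X Y : symmetric e ->
  [disjoint X & Y] -> #|X| = #|Y| -> 0 < #|X| ->
  (forall x y, x \in X -> y \in Y -> e x y) ->
  exists c, [/\ uniq c, cycle e c & c =i X :|: Y].
Proof.
move=> sym_e dXY eqXY X_gt0 full; exists (interleave (enum X) (enum Y)); split.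
- rewrite (perm_uniq (perm_interleave _ _)) cat_uniq !enum_uniq andbT /=.
  apply/hasPn => y; rewrite /= !mem_enum => yY; by rewrite (disjointFl dXY).
- have memX u : u \in enum X -> u \in X by rewrite mem_enum.
  have memY u : u \in enum Y -> u \in Y by rewrite mem_enum.
  move: X_gt0 eqXY memX memY; rewrite !cardE.
  case: (enum X) (enum Y) => [|a s] [|b t] //= _ [sz] memX memY.
  have aX : a \in X by rewrite memX ?mem_head.
  have bY : b \in Y by rewrite memY ?mem_head.
  have [|P L] := @path_interleave e b s t sz.
    move=> u v us vt; rewrite [e v u]sym_e andbb; apply: full.
      by rewrite memX // inE us orbT.
    by rewrite memY.
  by rewrite full // rcons_path P /= sym_e full // memY.
- by move=> z; rewrite (perm_mem (perm_interleave _ _)) mem_cat !mem_enum inE.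
Qed.

(** * Hamiltonicity with few missing edges *)

Lemma codeg_add_edge e S x y v : codeg (add_edge e x y) S v <= codeg e S v.
Proof.
apply/subset_leq_card/subsetP => w; rewrite !inE /add_edge.
by case/andP=> ->; rewrite negb_or => /andP[].
Qed.

Lemma nonedges_add_edge e X Y x y : x \in X -> y \in Y -> ~~ e x y ->
  nonedges (add_edge e x y) X Y < nonedges e X Y.
Proof.
move=> xX yY nxy; rewrite /nonedges (bigD1 x) //= [ltnRHS](bigD1 x) //=.
rewrite -addSn leq_add //; last by apply: leq_sum => z _; exact: codeg_add_edge.
apply/proper_card/properP; split.
  apply/subsetP => w; rewrite !inE /add_edge.
  by case/andP=> ->; rewrite negb_or => /andP[].
by exists y; rewrite !inE ?yY ?nxy // /add_edge !eqxx /= orbT.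
Qed.

Lemma nonedges_gt0 e X Y : 0 < nonedges e X Y ->
  exists x y, [/\ x \in X, y \in Y & ~~ e x y].
Proof.
rewrite lt0n sum_nat_eq0 negb_forall => /existsP[x].
rewrite negb_imply cards_eq0 => /andP[xX /set0Pn[y]].
by rewrite inE => /andP[yY nxy]; exists x, y.
Qed.

(* The invariant survives the insertion of an edge, so missing edges with
   small codegree sum can be added one at a time until the graph is complete;
   a missing edge [xy] with codegree sum at least [n] would force
   [d * (n - d) >= 2 * n - 4] missing edges, where [d] is the codegree of [x]. *)
Lemma dense_hamiltonian e X Y n : symmetric e -> bip_rel X Y e ->
  [disjoint X & Y] -> #|X| = n -> #|Y| = n -> 3 <= n ->
  (forall x, x \in X -> codeg e Y x + 2 <= n) ->
  (forall y, y \in Y -> codeg e X y + 2 <= n) ->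
  nonedges e X Y + 5 <= 2 * n \/
    (forall x y, x \in X -> y \in Y -> codeg e Y x <= 1 /\ codeg e X y <= 1) ->
  exists c, [/\ uniq c, cycle e c & c =i X :|: Y].
Proof.
have [m le_m] := ubnP (nonedges e X Y).
elim: m e le_m => // m IH e le_m sym_e bip dXY cX cY n_ge3 codX codY dense.
have [none|] := posnP (nonedges e X Y).
  apply: complete_bipartite_cycle => //; rewrite ?cX ?cY; try lia.
  move=> x y xX yY; apply: contraT => nxy.
  by have := nonedges_add_edge xX yY nxy; rewrite none.
case/nonedges_gt0 => x0 [y0 [x0X y0Y nxy0]].
have [x [y [xX yY nxy small]]] : exists x y,
    [/\ x \in X, y \in Y, ~~ e x y & codeg e Y x + codeg e X y < n].
  have [/existsP[y /and3P[yY nxy small]]|] :=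
      boolP [exists y, [&& y \in Y, ~~ e x0 y & codeg e Y x0 + codeg e X y < n]].
    by exists x0, y.
  rewrite negb_exists => /forallP large.
  have {}large y : y \in Y -> ~~ e x0 y -> n <= codeg e Y x0 + codeg e X y.
    by move=> yY nxy; have := large y; rewrite yY nxy /= -leqNgt.
  (* If all codegrees are at most 1, the sum at [x0], [y0] is at most 2 < n. Otherwise the codegree
     d of [x0] satisfies 2 <= d <= n - 2, so d(n - d) >= 2n - 4 edges are missing. *)
  have := large y0 y0Y nxy0.
  have := codX x0 x0X; have := codY y0 y0Y.
  case: dense => [sparse|/(_ x0 y0 x0X y0Y)]; last by clear -n_ge3; lia.
  have ge : codeg e Y x0 * (n - codeg e Y x0) <= nonedges e X Y.
    apply: nonedges_ge => // y yY nxy.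
    by have := large y yY nxy; clear; lia.
  by move: ge sparse; clear; nia.
have [||||||||||c [Uc Cc cE]] := IH (add_edge e x y) => //.
- by have := nonedges_add_edge xX yY nxy; move: le_m; clear; lia.
- exact: add_edge_sym.
- move=> a b /or3P[/bip//||] /andP[/eqP-> /eqP->]; by rewrite xX yY ?orbT.
- move=> z zX; apply: leq_trans (codX z zX).
  by rewrite leq_add2r codeg_add_edge.
- move=> z zY; apply: leq_trans (codY z zY).
  by rewrite leq_add2r codeg_add_edge.
- case: dense => [sparse|le1]; [left|right].
    by have := nonedges_add_edge xX yY nxy; move: sparse; clear; lia.
  move=> u v uX vY; have [le1u le1v] := le1 u v uX vY.
  by split; [apply: leq_trans le1u|apply: leq_trans le1v]; exact: codeg_add_edge.
apply: (@crossing_cycle e X Y x y c) => //; by rewrite cX ?cY.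
Qed.

(** Discarding the edges of [e] that do not join [X] to [Y] changes no codegree between them, so the
    previous result applies to subsets of the parts of a larger graph. *)
Lemma dense_hamiltonian_sub e X Y n : symmetric e ->
  [disjoint X & Y] -> #|X| = n -> #|Y| = n -> 3 <= n ->
  (forall x, x \in X -> codeg e Y x + 2 <= n) ->
  (forall y, y \in Y -> codeg e X y + 2 <= n) ->
  nonedges e X Y + 5 <= 2 * n \/
    (forall x y, x \in X -> y \in Y -> codeg e Y x <= 1 /\ codeg e X y <= 1) ->
  exists c, [/\ uniq c, cycle e c & size c = 2 * n].
Proof.
move=> sym_e dXY cX cY n_ge3 codX codY dense.
pose bip a b := (a \in X) && (b \in Y) || (a \in Y) && (b \in X).
pose f a b := e a b && bip a b.
have fX x : x \in X -> codeg f Y x = codeg e Y x.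
  move=> xX; apply: eq_card => y; rewrite !inE /f /bip xX.
  by case: (y \in Y); rewrite //= andbT.
have fY y : y \in Y -> codeg f X y = codeg e X y.
  move=> yY; apply: eq_card => x; rewrite !inE /f /bip yY.
  by case: (x \in X); rewrite //= orbT andbT.
have [|||||||||c [Uc Cc cE]] := @dense_hamiltonian f X Y n => //.
- by move=> a b; rewrite /f /bip sym_e orbC andbC [in RHS]andbC; congr (_ && _);
    congr (_ || _); rewrite andbC.
- by move=> a b /andP[].
- by move=> x xX; rewrite fX // codX.
- by move=> y yY; rewrite fY // codY.
- case: dense => [le|le1]; [left|right].
    by rewrite /nonedges (eq_bigr _ fX).
  by move=> x y xX yY; rewrite fX // fY //; exact: le1.
exists c; split=> //.
  by apply: sub_cycle Cc => a b /andP[].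
rewrite -(card_uniqP Uc) (eq_card cE) cardsU cX cY.
by rewrite (eqP (_ : X :&: Y == set0)) ?setI_eq0 // cards0; clear; lia.
Qed.

(** * Shorter cycles by vertex deletion *)

(** By inclusion-exclusion [x1] and [x2] have two common neighbours in [Y]. *)
Lemma four_cycle e Y x1 x2 : symmetric e -> x1 != x2 ->
  x1 \notin Y -> x2 \notin Y -> codeg e Y x1 + codeg e Y x2 + 2 <= #|Y| ->
  exists c, [/\ uniq c, cycle e c & size c = 4].
Proof.
move=> sym_e neq x1Y x2Y large.
pose A := [set w in Y | e x1 w]; pose B := [set w in Y | e x2 w].
have : 1 < #|A :&: B|.
  have := cardsUI A B; have : #|A :|: B| <= #|Y|.
    apply/subset_leq_card/subsetP => w; rewrite !inE.
    by case/orP => /andP[].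
  move: (codeg_card e Y x1) (codeg_card e Y x2) large; rewrite -/A -/B.
  by move: A B => A B; clear; lia.
case/card_gt1P => y1 [y2 []]; rewrite !inE.
case/andP=> /andP[y1Y e11] /andP[_ e21] /andP[/andP[y2Y e12] /andP[_ e22]] y12.
exists [:: x1; y1; x2; y2]; split=> //=.
  rewrite !inE !negb_or neq y12 !andbT /=.
  have out x y : x \notin Y -> y \in Y -> x != y.
    by move=> xn yY; apply: contraNneq xn => ->.
  by rewrite [y1 == x2]eq_sym !out.
by rewrite e11 e22 [e y1 _]sym_e e21 sym_e e12.
Qed.

Lemma codegD1 e (S : {set T}) z w : w \in S ->
  codeg e S z = codeg e (S :\ w) z + ~~ e z w.
Proof.
move=> wS; rewrite /codeg (cardsD1 w) inE wS /= addnC; congr (_ + _).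
by apply: eq_card => u; rewrite !inE; case: (u == w).
Qed.

(** The pair [x], [y], when missing, is counted in both codegrees. *)
Lemma nonedgesD1 e X Y x y : symmetric e -> x \in X -> y \in Y ->
  nonedges e (X :\ x) (Y :\ y) + codeg e Y x + codeg e X y
  = nonedges e X Y + ~~ e x y.
Proof.
move=> sym_e xX yY; rewrite /nonedges [in RHS](big_setD1 x) //=.
rewrite [in RHS](eq_bigr (fun z => codeg e (Y :\ y) z + ~~ e z y)); last first.
  by move=> z _; exact: codegD1.
rewrite big_split /= (codegD1 e y xX) [e y x]sym_e.
have -> : \sum_(z in X :\ x) ~~ e z y = codeg e (X :\ x) y.
  rewrite /codeg -sum1_card big_mkcond [RHS]big_mkcond.
  apply: eq_bigr => z _; rewrite !inE sym_e.
  by case: (z != x); case: (z \in X) => //=; case: (e y z).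
by move: (~~ e x y : nat) => b; clear; lia.
Qed.

(** The invariant of the deletion: parts of size [n], at most 2n - 5 missing edges, and at least two
    neighbours in the opposite part for every vertex. *)
Definition sparse_complement e X Y n :=
  [/\ [disjoint X & Y], #|X| = n /\ #|Y| = n, nonedges e X Y + 5 <= 2 * n,
      (forall x, x \in X -> codeg e Y x + 2 <= n) &
      (forall y, y \in Y -> codeg e X y + 2 <= n)].

Lemma codeg_sub e (S S' : {set T}) z : S \subset S' -> codeg e S z <= codeg e S' z.
Proof.
move=> /subsetP sub; apply/subset_leq_card/subsetP => w.
by rewrite !inE => /andP[/sub-> ->].
Qed.

Lemma codeg_le_nonedges e X Y x : x \in X -> codeg e Y x <= nonedges e X Y.
Proof. by move=> xX; rewrite /nonedges (bigD1 x) //= leq_addr. Qed.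

Lemma codeg2_le_nonedges e X Y x x' : x \in X -> x' \in X -> x != x' ->
  codeg e Y x + codeg e Y x' <= nonedges e X Y.
Proof.
move=> xX x'X neq; rewrite /nonedges (big_setD1 x) //= (big_setD1 x') //=.
  by rewrite addnA leq_addr.
by rewrite !inE eq_sym neq.
Qed.

(** The number of missing edges has to fall from at most 2n - 3 to at most 2n - 5, so the deleted
    pair must meet two of them, unless at most one is missing. *)
Lemma sparse_complement_del e X Y n : symmetric e -> 3 <= n ->
  sparse_complement e X Y n.+1 ->
  exists x y, sparse_complement e (X :\ x) (Y :\ y) n.
Proof.
move=> sym_e n_ge3 [dXY [cX cY] sp codX codY].
suff [x [y [xX yY le lX lY]]] : exists x y, [/\ x \in X, y \in Y,
    nonedges e (X :\ x) (Y :\ y) + 5 <= 2 * n,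
    (forall z, z \in X :\ x -> codeg e (Y :\ y) z + 2 <= n) &
    (forall z, z \in Y :\ y -> codeg e (X :\ x) z + 2 <= n)].
  exists x, y; split=> //.
    by apply: disjointWl (subsetDl _ _) _; apply: disjointWr (subsetDl _ _) _.
  by move: cX cY; rewrite (cardsD1 x X) xX (cardsD1 y Y) yY !add1n => -[->] [->].
have [x0 x0X] : exists x, x \in X.
  by apply/set0Pn; rewrite -card_gt0 cX.
have [y0 y0Y] : exists y, y \in Y.
  by apply/set0Pn; rewrite -card_gt0 cY.
have [le1|gt1] := leqP (nonedges e X Y) 1.
  exists x0, y0.
  have le : nonedges e (X :\ x0) (Y :\ y0) <= nonedges e X Y.
    have := nonedgesD1 sym_e x0X y0Y; have := codegD1 e x0 y0Y.
    by move: (~~ e x0 y0 : nat) => b; clear; lia.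
  have {}le : nonedges e (X :\ x0) (Y :\ y0) <= 1 by apply: leq_trans le1.
  split=> //; first by move: le n_ge3; clear; lia.
    move=> z zX; have := codeg_le_nonedges e (Y :\ y0) zX.
    by move: le n_ge3; clear; lia.
  move=> z zX; have := codeg_le_nonedges e (X :\ x0) zX.
  by rewrite nonedgesC //; move: le n_ge3; clear; lia.
case: (arg_maxnP (codeg e Y) x0X) => x xX maxx.
case: (arg_maxnP (codeg e X) y0Y) => y yY maxy.
have [two|one] := leqP (2 + ~~ e x y) (codeg e Y x + codeg e X y).
  exists x, y.
  have le : nonedges e (X :\ x) (Y :\ y) + 5 <= 2 * n.
    have := nonedgesD1 sym_e xX yY; move: two sp.
    by move: (~~ e x y : nat) => b; clear; lia.
  (* A remaining vertex has codegree at most that of the deleted vertex of its part, and the two sum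
     to at most 2n - 3; hence it is at most n - 2. *)
  split=> // z; rewrite inE => /andP[]; rewrite inE => neq zS.
    have := codeg2_le_nonedges e Y xX zS; rewrite eq_sym neq => /(_ isT).
    have := maxx z zS; have := codeg_sub e z (subsetDl Y [set y]).
    by move: sp; clear; lia.
  have := codeg2_le_nonedges e X yY zS; rewrite eq_sym neq => /(_ isT).
  have := maxy z zS; have := codeg_sub e z (subsetDl X [set x]).
  by rewrite nonedgesC //; move: sp; clear; lia.
have [x1 [y1 [x1X y1Y nxy1]]] : exists x y, [/\ x \in X, y \in Y & ~~ e x y].
  by apply: nonedges_gt0; apply: leq_trans gt1.
have := maxx x1 x1X; have := maxy y1 y1Y.
rewrite (codegD1 e x1 y1Y) (codegD1 e y1 x1X) nxy1 [e y1 x1]sym_e nxy1.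
move=> gy gx.
(* The maximal codegrees are 1, so the missing edges form a matching containing xy. Deleting [x] and
   [y] would remove only one of them, so [x] is replaced by the end [x2] of another. *)
have [nxy cx1 cy1] : [/\ ~~ e x y, codeg e Y x = 1 & codeg e X y = 1].
  by move: one gx gy; case: (e x y) => /= one gx gy; split=> //; clear -one gx gy; lia.
have [x2 [x2X nx2 nxy2]] : exists x', [/\ x' \in X, x' != x & 0 < codeg e Y x'].
  move: gt1; rewrite /nonedges (big_setD1 x) //= cx1 ltnS lt0n sum_nat_eq0.
  rewrite negb_forall => /existsP[x']; rewrite negb_imply !inE -lt0n.
  by case/andP => /andP[? ?] ?; exists x'.
have c2 : codeg e Y x2 = 1 by have := maxx x2 x2X; rewrite cx1; move: nxy2; clear; lia.
have e2 : e x2 y.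
  apply: contraT => n2; have := codegD1 e y x2X; rewrite [e y x2]sym_e n2 cy1.
  have xX2 : x \in X :\ x2 by rewrite !inE eq_sym nx2.
  by rewrite (codegD1 e y xX2) [e y x]sym_e nxy; clear; lia.
exists x2, y; split=> //.
- by have := nonedgesD1 sym_e x2X yY; rewrite c2 cy1 e2; move: sp; clear; lia.
- move=> z; rewrite inE => /andP[_ zX].
  have := maxx z zX; have := codeg_sub e z (subsetDl Y [set y]).
  by rewrite cx1; move: n_ge3; clear; lia.
- move=> z; rewrite inE => /andP[_ zY].
  have := maxy z zY; have := codeg_sub e z (subsetDl X [set x2]).
  by rewrite cy1; move: n_ge3; clear; lia.
Qed.

Lemma sparse_complement_cycles e X Y n k : symmetric e -> 3 <= n ->
  sparse_complement e X Y n -> 2 <= k <= n ->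
  exists c, [/\ uniq c, cycle e c & size c = 2 * k].
Proof.
move=> sym_e n_ge3 sp; elim: n n_ge3 X Y sp => // n IH n_ge3 X Y sp /andP[k2 kn].
have [dXY [cX cY] le codX codY] := sp.
have [->|neq_kn] := eqVneq k n.+1.
  by apply: (@dense_hamiltonian_sub e X Y) => //; left.
have {}kn : k <= n by move: kn neq_kn; clear; lia.
have [n3|] := leqP 3 n; last first.
  (* The parts have size 3 and at most one edge is missing, so any two vertices of [X] have two
     common neighbours. *)
  move=> n_lt3; have -> : k = 2 by move: n_lt3 k2 kn; clear; lia.
  have : 1 < #|X| by rewrite cX; move: n_ge3; clear; lia.
  case/card_gt1P => x1 [x2 [x1X x2X neq]].
  apply: (@four_cycle e Y x1 x2) => //; rewrite ?(disjointFr dXY) //.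
  have := codeg2_le_nonedges e Y x1X x2X neq; rewrite cY.
  by move: le n_lt3 n_ge3; clear; lia.
have [x [y sp']] := sparse_complement_del sym_e n3 sp.
by apply: (IH n3 _ _ sp'); rewrite k2.
Qed.

(* Vertex deletion alone does not reach the 4-cycle here: [K_{3,3}] minus a
   perfect matching is a 6-cycle. *)
Lemma near_complete44_cycles e X Y k : symmetric e -> [disjoint X & Y] ->
  #|X| = 4 -> #|Y| = 4 ->
  (forall x y, x \in X -> y \in Y -> codeg e Y x <= 1 /\ codeg e X y <= 1) ->
  2 <= k <= 4 -> exists c, [/\ uniq c, cycle e c & size c = 2 * k].
Proof.
move=> sym_e dXY cX cY le1 /andP[k2 k4].
have [x1 [x2 [x1X x2X neq]]] : exists x1 x2, [/\ x1 \in X, x2 \in X & x1 != x2].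
  have /card_gt1P[x1 [x2 [? ? ?]]] : 1 < #|X| by rewrite cX.
  by exists x1, x2.
have [y1 y1Y] : exists y, y \in Y by apply/set0Pn; rewrite -card_gt0 cY.
have leX x : x \in X -> codeg e Y x <= 1 by move=> xX; case: (le1 x y1 xX y1Y).
have leY y : y \in Y -> codeg e X y <= 1 by move=> yY; case: (le1 x1 y x1X yY).
have [->|nk4] := eqVneq k 4.
  apply: (@dense_hamiltonian_sub e X Y) => //; last by right.
    by move=> x /leX; clear; lia.
  by move=> y /leY; clear; lia.
have [->|nk3] := eqVneq k 3.
  have leX' x : x \in X :\ x1 -> codeg e (Y :\ y1) x <= 1.
    rewrite inE => /andP[_ /leX]; apply: leq_trans.
    exact: codeg_sub (subsetDl _ _).
  have leY' y : y \in Y :\ y1 -> codeg e (X :\ x1) y <= 1.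
    rewrite inE => /andP[_ /leY]; apply: leq_trans.
    exact: codeg_sub (subsetDl _ _).
  apply: (@dense_hamiltonian_sub e (X :\ x1) (Y :\ y1)) => //.
  - by apply: disjointWl (subsetDl _ _) _; apply: disjointWr (subsetDl _ _) _.
  - by move: cX; rewrite (cardsD1 x1 X) x1X add1n => -[].
  - by move: cY; rewrite (cardsD1 y1 Y) y1Y add1n => -[].
  - by move=> x /leX'; clear; lia.
  - by move=> y /leY'; clear; lia.
  - by right=> x y xX yY; rewrite leX' // leY'.
have -> : k = 2 by move: k2 k4 nk3 nk4; clear; lia.
apply: (@four_cycle e Y x1 x2) => //; rewrite ?(disjointFr dXY) //.
by rewrite cY; have := leX _ x1X; have := leX _ x2X; clear; lia.
Qed.
End Bipartite.

(** * Eigenvalues of the signless Laplacian *)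

Section Spectral.
Local Open Scope ring_scope.
Variables (R : realType) (G : sgraph).

Definition neighbour_degree_sum (v : G) : nat := (\sum_(w | adj v w) deg w)%N.

(** The entries of a row eigenvector are reindexed by vertices; symmetry of [adj] turns a column sum
    into a sum over neighbours. *)
Lemma signless_eigenvector (q : R) : eigenvalue (signless_laplacian G R) q ->
  exists2 f : G -> R, (exists v, f v != 0) &
    forall v, q * f v = (deg v)%:R * f v + \sum_(w | adj v w) f w.
Proof.
case/eigenvalueP => u uQ u0.
exists (fun v => u 0 (enum_rank v)).
  case/rV0Pn: u0 => i ui; exists (enum_val i); by rewrite enum_valK.
move=> v; have := congr1 (fun M : 'rV_ _ => M 0 (enum_rank v)) uQ.
rewrite !mxE => <-.
under eq_bigr do rewrite !mxE mulrDr.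
rewrite big_split /=; congr (_ + _).
  rewrite (bigD1 (enum_rank v)) //= big1 ?addr0 => [|i /negPf ni].
    by rewrite eqxx mulr1n enum_rankK mulrC.
  by rewrite ni mulr0n mulr0.
rewrite [RHS](reindex_onto enum_val enum_rank) => [|w _]; last by rewrite enum_rankK.
rewrite [RHS]big_mkcond /=; apply: eq_bigr => i _.
rewrite enum_valK eqxx andbT enum_rankK adj_sym.
by case: (adj v _); rewrite ?mulr1 ?mulr0.
Qed.

(* Scale the eigenvector by the degrees: where [|f v| / deg v] is maximal the
   eigenvalue equation gives the bound, and equality there forces the maximum
   at every neighbour. *)
Lemma signless_eigenvalue_bound (q : R) : connected_graph G ->
  (forall v : G, (0 < deg v)%N) -> eigenvalue (signless_laplacian G R) q ->
  (exists v : G,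
     q * (deg v)%:R < (deg v * deg v + neighbour_degree_sum v)%:R) \/
  (forall v : G,
     q * (deg v)%:R <= (deg v * deg v + neighbour_degree_sum v)%:R).
Proof.
move=> connG deg_gt0 /signless_eigenvector[f [v0 fv0] fE].
pose d (v : G) : R := (deg v)%:R.
have d_gt0 v : 0 < d v by rewrite ltr0n.
pose g v := `|f v| / d v.
have fg v : `|f v| = g v * d v by rewrite /g divfK // gt_eqF.
case: (arg_maxP (P := xpredT) g (i0 := v0) isT) => vm _ gmax.
pose M := g vm.
have M_gt0 : 0 < M.
  by apply: lt_le_trans (gmax v0 isT); rewrite divr_gt0 ?normr_gt0.
have M_neq0 : M != 0 by rewrite gt_eqF.
have {}gmax v : g v <= M by exact: gmax.
have gvm : g vm = M by [].
clearbody M; clearbody g.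
have sumE v : (neighbour_degree_sum v)%:R = \sum_(w | adj v w) d w :> R.
  by rewrite natr_sum.
(* Triangle inequality in the eigenvalue equation, divided by [M]. The weights [g w / M] are kept,
   since [step] needs to detect one below 1. *)
have bound v : g v = M -> q * d v <= d v * d v + \sum_(w | adj v w) g w / M * d w.
  move=> gv; rewrite -(ler_pM2r M_gt0) -mulrA [d v * M]mulrC -gv -fg.
  apply: le_trans (_ : `|q * f v| <= _).
    rewrite normrM; apply: ler_wpM2r => //; exact: ler_norm.
  rewrite fE; apply: le_trans (ler_normD _ _) _.
  rewrite mulrDl normrM (ger0_norm (ltW (d_gt0 v))) fg gv.
  apply: lerD; first by rewrite [M * d v]mulrC mulrA.
  apply: le_trans (ler_norm_sum _ _ _) _; rewrite mulr_suml.
  by apply: ler_sum => w _; rewrite fg mulrAC divfK.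
have [/existsP[v lt]|] := boolP [exists v : G,
    q * (deg v)%:R < (deg v * deg v + neighbour_degree_sum v)%:R].
  by left; exists v.
rewrite negb_exists => /forallP nlt; right.
suff allM v : g v = M.
  move=> v; apply: le_trans (bound v (allM v)) _.
  rewrite natrD natrM sumE lerD2l; apply: ler_sum => w _.
  by rewrite allM divff ?mul1r.
(* A neighbour below the maximum would make the bound at [a] strict, against [nlt]; connectedness
   then carries the maximum to every vertex. *)
have step a b : adj a b -> g a = M -> g b = M.
  move=> ab ga; apply/eqP; rewrite eq_le (gmax b) //= leNgt; apply/negP => gb.
  move: (nlt a) => /negP; apply; apply: le_lt_trans (bound a ga) _.
  rewrite natrD natrM sumE ltrD2l (bigD1 b) //= [ltRHS](bigD1 b) //=.
  apply: ltr_leD.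
    by rewrite gtr_pMl // ltr_pdivrMr // mul1r.
  apply: ler_sum => u _; rewrite ger_pMl // ler_pdivrMr // mul1r; exact: gmax.
case/connectP: (connG vm v) => p.
elim: p vm gvm => [|w p IH] z gz /=; first by move=> _ ->.
by case/andP => zw; apply: IH; apply: step gz.
Qed.
End Spectral.

(** * Arithmetic of the eigenvalue bound *)

(** [E] and [m] stand for the present and the missing edges. The last hypothesis is the bound on q1
    multiplied by nd, with the negative term moved across to stay in the naturals. *)
Lemma dense_of_strict_bound n d S E m : 4 <= n -> 0 < d <= n -> S <= d * n ->
  S <= E -> E + m = n * n ->
  d * (2 * (n * n) + 4) < n * (d * d + S) + 2 * (n * d) -> m + 5 <= 2 * n.
Proof.
move=> n4 /andP[d0 dn] Sdn SE Em lt.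
(* If d <= n - 2, then nd + n^2 + 2n <= 2n^2, below the required 2n^2 + 4. *)
have dge : n <= d.+1.
  rewrite leqNgt; apply/negP => lt_dn.
  have : d * (2 * (n * n) + 4) < d * (n * d + n * n + 2 * n).
    have : n * S <= n * (d * n) by rewrite leq_mul2l Sdn orbT.
    by move: lt; clear; nia.
  by rewrite ltn_pmul2l //; move: lt_dn; clear; nia.
have [dE|dE] : d = n \/ d = n.-1 by move: dn dge; clear; lia.
  by move: lt n4 SE Em; rewrite dE; clear; nia.
(* For d = n - 1 the bound reads S > n^2 - 2n + 5 - 4/n, and 4/n <= 1 gives S >= n^2 - 2n + 5. *)
case: n n4 dE {dge dn Sdn} Em lt => // n n4 /= -> Em lt.
by move: lt n4 SE Em; clear; nia.
Qed.

(** The slack of 4 in the same estimate excludes d <= n - 2 under the weak inequality too. *)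
Lemma degree_of_weak_bound n d S : 4 <= n -> 0 < d -> S <= d * n ->
  d * (2 * (n * n) + 4) <= n * (d * d + S) + 2 * (n * d) -> n <= d.+1.
Proof.
move=> n4 d0 Sdn le; rewrite leqNgt; apply/negP => lt_dn.
have : d * (2 * (n * n) + 4) <= d * (n * d + n * n + 2 * n).
  have : n * S <= n * (d * n) by rewrite leq_mul2l Sdn orbT.
  by move: le; clear; nia.
by rewrite leq_pmul2l //; move: lt_dn; clear; nia.
Qed.

(** * Degrees in a balanced bipartite graph *)

Lemma bipartite_disjoint (G : sgraph) (X Y : {set G}) :
  bipartite_with X Y -> [disjoint X & Y].
Proof. by case=> _ XY _; rewrite -setI_eq0 XY. Qed.

Lemma bipartite_codeg_deg (G : sgraph) (X Y : {set G}) n x :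
  bipartite_with X Y -> #|Y| = n -> x \in X -> codeg (@adj G) Y x + deg x = n.
Proof.
move=> bipG cY xX; rewrite -cY -(codeg_card (@adj G) Y x); congr (_ + _).
apply: eq_card => y; rewrite !inE; case E: (adj x y); last by rewrite andbF.
have [_ _ /(_ x y E)] := bipG.
by rewrite xX (disjointFr (bipartite_disjoint bipG) xX) /= orbF => ->.
Qed.

Lemma bipartite_withC (G : sgraph) (X Y : {set G}) :
  bipartite_with X Y -> bipartite_with Y X.
Proof.
by case=> U I E; split=> [||x y /E]; rewrite ?[Y :|: X]setUC ?[Y :&: X]setIC // orbC.
Qed.

Lemma bipartite_nonedges_sum_deg (G : sgraph) (X Y : {set G}) n :
  bipartite_with X Y -> #|X| = n -> #|Y| = n ->
  \sum_(y in Y) deg y + nonedges (@adj G) X Y = n * n.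
Proof.
move=> bipG cX cY; rewrite -nonedgesC; last exact: adj_sym.
rewrite /nonedges -big_split /=.
rewrite (eq_bigr (fun=> n)) ?sum_nat_const ?cY // => y yY.
by rewrite addnC (bipartite_codeg_deg (bipartite_withC bipG) cX yY).
Qed.

Lemma bipartite_neighbour_degree_sum (G : sgraph) (X Y : {set G}) n x :
  bipartite_with X Y -> #|X| = n -> #|Y| = n -> x \in X ->
  neighbour_degree_sum x <= deg x * n /\
  neighbour_degree_sum x <= \sum_(y in Y) deg y.
Proof.
move=> bipG cX cY xX.
have nbrY y : adj x y -> y \in Y.
  have [_ _ E] := bipG; move/E.
  by rewrite xX (disjointFr (bipartite_disjoint bipG) xX) /= orbF.
split; last first.
  rewrite /neighbour_degree_sum big_mkcond [leqRHS]big_mkcond leq_sum // => y _.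
  by case: ifP => // /nbrY->.
rewrite /neighbour_degree_sum /deg -sum_nat_const.
rewrite [leqRHS](eq_bigl (adj x)) => [|y]; last by rewrite inE.
apply: leq_sum => y /nbrY yY.
by have := bipartite_codeg_deg (bipartite_withC bipG) cX yY; rewrite /deg; lia.
Qed.

Lemma min_degree_le (G : sgraph) (v : G) : min_degree G <= deg v.
Proof.
rewrite /min_degree; have := mem_index_enum v.
elim: (index_enum G) => // w s IH; rewrite inE big_cons.
by case/predU1P => [<-|/IH]; rewrite ?geq_minl // geq_min => ->; rewrite orbT.
Qed.

Local Open Scope ring_scope.

(** * From the eigenvalue bound to bipancyclicity *)

Theorem theorem3 (R : realType) (G : sgraph) (X Y : {set G})
    (n e delta : nat) (q1 : R)
    (bipartiteG : bipartite_with X Y)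
    (balancedG : #|X| = #|Y|)
    (connectedG : connected_graph G)
    (orderG : #|G| = (2 * n)%N)
    (n_ge4 : (4 <= n)%N)
    (sizeG : #|edges G| = e)
    (min_degreeG : min_degree G = delta)
    (delta_ge2 : (2 <= delta)%N)
    (q1_largest : largest_eigenvalue (signless_laplacian G R) q1)
    (q1_bound : 2 * (n%:R ^+ 2 - n%:R + 2) / n%:R <= q1) :
  bipancyclic G.
Proof.
have [coverXY _ _] := bipartiteG.
have dXY := bipartite_disjoint bipartiteG.
have cX : #|X| = n.
  have := cardsUI X Y; rewrite coverXY cardsT orderG -balancedG.
  by rewrite (disjoint_setI0 dXY) cards0; clear; lia.
have cY : #|Y| = n by rewrite -balancedG.
have deg2 (v : G) : (2 <= deg v)%N.
  by apply: leq_trans delta_ge2 _; rewrite -min_degreeG min_degree_le.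
have codX x : x \in X -> (codeg (@adj G) Y x + deg x = n)%N.
  exact: bipartite_codeg_deg bipartiteG cY.
have codY y : y \in Y -> (codeg (@adj G) X y + deg y = n)%N.
  exact: bipartite_codeg_deg (bipartite_withC bipartiteG) cX.
have side (v : G) : v \in X \/ v \in Y.
  by apply/orP; have := in_setT v; rewrite -coverXY inE.
(* The second inequality says that the neighbour degree sum is at most the number of edges. *)
have sumP (v : G) : (neighbour_degree_sum v <= deg v * n)%N /\
    (neighbour_degree_sum v + nonedges (@adj G) X Y <= n * n)%N.
  case: (side v) => vS.
    have [? le] := bipartite_neighbour_degree_sum bipartiteG cX cY vS.
    by split=> //; rewrite -(bipartite_nonedges_sum_deg bipartiteG cX cY) leq_add2r.
  have bipC := bipartite_withC bipartiteG.
  have [? le] := bipartite_neighbour_degree_sum bipC cY cX vS.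
  split=> //; rewrite -(bipartite_nonedges_sum_deg bipC cY cX) nonedgesC ?leq_add2r //.
  exact: adj_sym.
have n_gt0 : (0 : R) < n%:R by rewrite ltr0n (leq_trans _ n_ge4).
have q1n : 2 * (n%:R ^+ 2 - n%:R + 2) <= q1 * n%:R by rewrite -ler_pdivrMr.
have scaled (v : G) : (deg v * (2 * (n * n) + 4))%:R
    <= q1 * (deg v)%:R * n%:R + (2 * (n * deg v))%:R :> R.
  have := ler_wpM2r (ler0n R (deg v)) q1n.
  by rewrite !natrM !natrD !natrM; lra.
have cyclesP : (forall k, 2 <= k <= n -> exists c : seq G,
    [/\ uniq c, cycle (@adj G) c & size c = 2 * k])%N -> bipancyclic G.
  move=> cycs k even_k /andP[k4 kG].
  have kE : (k = 2 * k./2)%N by rewrite -[LHS](odd_double_half k) (negPf even_k) -mul2n.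
  have [|c [Uc Cc cE]] := cycs k./2; first by move: k4 kG; rewrite orderG {1 2}kE; clear; lia.
  split; first exact: leq_trans k4.
  by exists c; split; rewrite ?cE // /ucycle Cc.
have sparse_case : (nonedges (@adj G) X Y + 5 <= 2 * n)%N -> bipancyclic G.
  move=> sparse; apply: cyclesP => k kn.
  apply: (@sparse_complement_cycles _ _ X Y n) => //; first exact: adj_sym.
    exact: leq_trans n_ge4.
  split=> // v vS; have := deg2 v.
    by have := codX v vS; clear; lia.
  by have := codY v vS; clear; lia.
have deg_gt0 (v : G) : (0 < deg v)%N by apply: leq_trans (deg2 v).
have degn (v : G) : (deg v <= n)%N.
  by case: (side v) => [/codX|/codY] <-; rewrite leq_addl.
have [eig _] := q1_largest.
case: (signless_eigenvalue_bound connectedG deg_gt0 eig) => [[v lt]|le].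
  apply: sparse_case; have [Sd Sm] := sumP v.
  apply: (@dense_of_strict_bound n (deg v) (neighbour_degree_sum v)
            (n * n - nonedges (@adj G) X Y)) => //.
  - by rewrite deg_gt0 degn.
  - by move: Sm; clear; lia.
  - by rewrite subnK //; move: Sm; clear; lia.
  rewrite -(ltr_nat R); apply: le_lt_trans (scaled v) _.
  by rewrite natrD ltrD2r natrM mulrC ltr_pM2l.
(* In the weak case every vertex misses at most one vertex of the other part. *)
have codeg1 (v : G) : (n <= (deg v).+1)%N.
  have [Sd Sm] := sumP v.
  apply: (@degree_of_weak_bound n (deg v) (neighbour_degree_sum v)) => //.
  rewrite -(ler_nat R); apply: le_trans (scaled v) _.
  by rewrite natrD lerD2r natrM mulrC ler_pM2l.
have leX x : x \in X -> (codeg (@adj G) Y x <= 1)%N.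
  by move=> /codX; have := codeg1 x; clear; lia.
have leY y : y \in Y -> (codeg (@adj G) X y <= 1)%N.
  by move=> /codY; have := codeg1 y; clear; lia.
(* At most [n] edges are missing, and n <= 2n - 5 once n >= 5; only n = 4 needs separate
   treatment. *)
have [n4|n_gt4] := leqP n 4; last first.
  apply: sparse_case; have : (nonedges (@adj G) X Y <= n)%N.
    by rewrite -cX -sum1_card; exact: leq_sum.
  by move: n_gt4; clear; lia.
have nE : n = 4%N by apply/eqP; rewrite eqn_leq n4.
apply: cyclesP => k; rewrite nE => k4.
apply: (@near_complete44_cycles _ _ X Y) => //; rewrite ?cX ?cY //; first exact: adj_sym.
by move=> x y xX yY; rewrite leX // leY.
Qed.
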